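(* Let $n\ge 3$ be an integer. For an $n\times n$ maximum arrangement of prisoners and guards, the number of prisoners, $P(n)$, satisfies the inequality $$P(n)\le \frac{7n^2+4n}{11}.$$
   Context: A configuration on an $n\times n$ board assigns to each of the $n^2$ squares exactly one occupant, either a prisoner or a guard. Two distinct squares are adjacent if one is directly above, below, to the left, to the right, or diagonal to the other (king-move adjacency). A configuration is valid (a valid board) if every square occupied by a prisoner is adjacent to at least as many squares occupied by guards as squares occupied by (other) prisoners. A maximum configuration (maximum arrangement) is a valid board that has the greatest number of prisoners among all valid boards on the $n\times n$ board. $P(n)$ denotes the number of prisoners in a maximum configuration on the $n\times n$ board. *)

(* Defs.v *)
From mathcomp Require Import all_boot all_order all_algebra.

Set Implicit Arguments.
Unset Strict Implicit.
Unset Printing Implicit Defensive.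

Definition square (n : nat) : finType := ('I_n * 'I_n)%type.

Definition adjacent (n : nat) : rel (square n) := fun x y =>
  [&& x != y,
      (x.1 <= y.1.+1) && (y.1 <= x.1.+1) &
      (x.2 <= y.2.+1) && (y.2 <= x.2.+1)].

(* A configuration is given by its set of prisoner squares; every other square
   holds a guard. *)
Definition configuration (n : nat) : finType := {set square n}.

Definition prisoners (n : nat) (c : configuration n) : {set square n} := c.

Definition guards (n : nat) (c : configuration n) : {set square n} := ~: c.

Definition valid (n : nat) (c : configuration n) : bool :=
  [forall x in prisoners c,
     #|[set y in prisoners c | adjacent x y]|
       <= #|[set y in guards c | adjacent x y]|].

Definition maximum_configuration (n : nat) (c : configuration n) : bool :=
  valid c &&
  [forall d : configuration n, valid d ==> (#|prisoners d| <= #|prisoners c|)].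

Definition P (n : nat) : nat :=
  \max_(c : configuration n | valid c) #|prisoners c|.

Lemma valid_no_prisoners (n : nat) : valid (set0 : configuration n).
Proof. by apply/forall_inP => x; rewrite inE. Qed.

Lemma card_maximum_configuration (n : nat) (c : configuration n) :
  maximum_configuration c -> #|prisoners c| = P n.
Proof.
case/andP=> vc /forallP maxc; apply/eqP; rewrite eqn_leq; apply/andP; split.
  exact: (leq_bigmax_cond (F := fun d : configuration n => #|prisoners d|)).
by apply/bigmax_leqP => d vd; have := maxc d; rewrite vd.
Qed.

Lemma exists_maximum_configuration (n : nat) :
  exists c : configuration n, maximum_configuration c.
Proof.
have [c vc maxc] :=
  arg_maxnP (fun d : configuration n => #|prisoners d|) (valid_no_prisoners n).
exists c; apply/andP; split=> //.
by apply/forallP => d; apply/implyP => vd; apply: maxc.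
Qed.

(* Main.v *)
Require Import Defs.
From mathcomp Require Import all_boot all_order all_algebra.
From mathcomp Require Import zify.

Set Implicit Arguments.
Unset Strict Implicit.
Unset Printing Implicit Defensive.

Import GRing.Theory Num.Theory.

(** Count the adjacent prisoner-guard pairs.  A prisoner sees at least 4 guards,
   up to a defect of 1 per side of the board it touches, and these defects add
   up to at most [4 * n].  So it is enough that a guard sees 7 prisoners on
   average.  It sees more only if it is isolated, i.e. surrounded by 8
   prisoners; its right neighbour then already sees four prisoners, so the
   three squares two columns to the right are all guards, and the middle one
   sees at most 6 prisoners.  As translation by two columns is injective, this
   compensates for the isolated guards. *)

(** * Neighbourhoods on a line of [n] cells *)

Section Interval.

Variable n : nat.

Definition near (i : 'I_n) : {set 'I_n} :=
  [set k : 'I_n | (i <= k.+1) && (k <= i.+1)].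

(** For [n = 1] both ends coincide and the value is 2, which keeps [card_near] exact. *)
Definition border_count (i : 'I_n) : nat := (i == 0 :> nat) + (i.+1 == n).

Lemma sum_ord_eq (m : nat) : \sum_(k < n) (k == m :> nat) = (m < n).
Proof.
have [lt_mn|le_nm] := ltnP m n.
  rewrite (bigD1 (Ordinal lt_mn)) //= eqxx big1 // => k.
  by rewrite -val_eqE /= => /negbTE ->.
by rewrite big1 // => k _; have := ltn_ord k; lia.
Qed.

Lemma card_ord_eq (m : nat) : #|[set k : 'I_n | k == m :> nat]| = (m < n).
Proof.
by rewrite -sum1dep_card big_mkcond -sum_ord_eq; apply: eq_bigr => k _; case: eqP.
Qed.

Lemma card_near (i : 'I_n) : #|near i| + border_count i = 3.
Proof.
(* The factor [0 < i] prevents the truncated [i.-1] from counting cell 0 twice. *)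
have -> : #|near i| = \sum_(k < n)
    ((k == i :> nat) + (k == i.+1 :> nat) + (0 < i) * (k == i.-1 :> nat)).
  rewrite -sum1dep_card big_mkcond; apply: eq_bigr => k _.
  by case: ifP; lia.
rewrite !big_split -big_distrr /= !sum_ord_eq /border_count.
by have := ltn_ord i; lia.
Qed.

Lemma sum_border_count : \sum_(i < n) border_count i <= 2.
Proof.
rewrite big_split /= sum_ord_eq.
under eq_bigr => i _ do
  have -> : (i.+1 == n) = (i == n.-1 :> nat) by have := ltn_ord i; lia.
by rewrite sum_ord_eq; lia.
Qed.

Lemma border_count_le1 (i : 'I_n) : 1 < n -> border_count i <= 1.
Proof. by rewrite /border_count; lia. Qed.

End Interval.

(** * Neighbourhoods on the board *)

Section Board.

Variable n : nat.
Implicit Types x y z : square n.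

Definition side_count x : nat := border_count x.1 + border_count x.2.

Lemma sum_side_count : \sum_x side_count x <= 4 * n.
Proof.
have -> : \sum_x side_count x =
    \sum_(i < n) \sum_(j < n) (border_count i + border_count j).
  by rewrite pair_bigA.
under eq_bigr => i _ do rewrite big_split /= sum_nat_const card_ord.
rewrite big_split /= sum_nat_const card_ord -big_distrr /=.
rewrite -mulnDr mulnC leq_mul2r; apply/orP; right.
exact: leq_add (sum_border_count n) (sum_border_count n).
Qed.

Lemma adjacent_sym x y : adjacent x y = adjacent y x.
Proof. by rewrite /adjacent eq_sym andbC; lia. Qed.

Lemma adjacentE x y : adjacent x y = (y != x) && (y \in setX (near x.1) (near x.2)).
Proof. by rewrite /adjacent !inE eq_sym. Qed.

Definition neighbours x : {set square n} := [set y | adjacent x y].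

(** The product of the two intervals is the neighbourhood together with [x] itself. *)
Lemma card_neighbours x : #|neighbours x|.+1 = #|near x.1| * #|near x.2|.
Proof.
rewrite -cardsX [RHS](cardsD1 x) !inE !leqnSn /= add1n; congr _.+1.
by apply: eq_card => y; rewrite inE adjacentE in_setD1.
Qed.

(** * Adjacent prisoner-guard pairs *)

Variable c : configuration n.

Definition prisoners_at x : {set square n} :=
  [set y in prisoners c | adjacent x y].
Definition guards_at x : {set square n} := [set y in guards c | adjacent x y].

Lemma card_prisoners_guards_at x :
  #|prisoners_at x| + #|guards_at x| = #|neighbours x|.
Proof.
rewrite -(cardsID c (neighbours x)); congr (_ + _);
  by apply: eq_card => y; rewrite !inE andbC.
Qed.

Lemma sum_guards_at :
  \sum_(x in prisoners c) #|guards_at x| = \sum_(y in guards c) #|prisoners_at y|.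
Proof.
under eq_bigr => x _ do rewrite -sum1dep_card.
rewrite (exchange_big_dep (mem (guards c))) /=; last by move=> x y _ /andP[].
apply: eq_bigr => y gy; rewrite -sum1dep_card.
by apply: eq_bigl => x; rewrite gy adjacent_sym.
Qed.

Hypothesis n_gt1 : 1 < n.

Lemma card_neighbours_le8 x : #|neighbours x| <= 8.
Proof.
have := card_neighbours x; have := card_near x.1; have := card_near x.2; nia.
Qed.

(** With border counts [a] and [b] in {0, 1}, the right side is [(3 - a)(3 - b) - 1 + 2a + 2b = 7 +
    (1 - a)(1 - b)]. *)
Lemma card_neighbours_ge x : 7 <= #|neighbours x| + 2 * side_count x.
Proof.
rewrite /side_count; have := card_neighbours x.
have := border_count_le1 x.1 n_gt1; have := border_count_le1 x.2 n_gt1.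
have := card_near x.1; have := card_near x.2; nia.
Qed.

Hypothesis valid_c : valid c.

Lemma prisoners_at_le_guards_at x :
  x \in prisoners c -> #|prisoners_at x| <= #|guards_at x|.
Proof. by move/forall_inP: valid_c; apply. Qed.

(** At least half of the neighbours are guards, and half of 7 rounds up to 4. *)
Lemma guards_at_ge x : x \in prisoners c -> 4 <= #|guards_at x| + side_count x.
Proof.
move=> /prisoners_at_le_guards_at; have := card_prisoners_guards_at x.
by have := card_neighbours_ge x; lia.
Qed.

(** * Isolated guards and the guards two columns to their right *)

Definition isolated_guards : {set square n} :=
  [set x in guards c | 7 < #|prisoners_at x|].

(* Outside the board, the second coordinate is left unchanged. *)
Definition shift2 x : square n := (x.1, insubd x.2 x.2.+2).

Lemma isolated_guardP x : x \in isolated_guards ->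
  [/\ #|near x.1| = 3, #|near x.2| = 3 &
      forall y, adjacent x y -> y \in prisoners c].
Proof.
rewrite inE => /andP[_ gt7].
have sub : prisoners_at x \subset neighbours x.
  by apply/subsetP => y; rewrite !inE => /andP[].
have le8 := card_neighbours_le8 x; have := subset_leq_card sub => le_pn.
have := card_neighbours x; have := card_near x.1; have := card_near x.2.
move=> h2 h1 hN; split; try nia.
have /eqP eqN : prisoners_at x == neighbours x by rewrite eqEcard sub; lia.
move=> y adj; have : y \in neighbours x by rewrite inE.
by rewrite -eqN inE => /andP[].
Qed.

Lemma guards_right_of_isolated x : x \in isolated_guards ->
  x.2.+2 < n /\
  (forall z, z.1 \in near x.1 -> z.2 = x.2.+2 :> nat -> z \in guards c).
Proof.
move=> Ax; have [near1 near2 nbr] := isolated_guardP Ax.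
have lt1 : x.2.+1 < n.
  by have := card_near x.2; rewrite near2 /border_count; have := ltn_ord x.2; lia.
pose y : square n := (x.1, Ordinal lt1).
have py : y \in prisoners c.
  apply: nbr; rewrite adjacentE !inE /= -pair_eqE /= -!val_eqE /=.
  by lia.
have gp := prisoners_at_le_guards_at py.
have near_y2 : #|near y.2| = 3 - (x.2.+2 == n).
  by have := card_near y.2; rewrite /border_count /=; lia.
have := card_neighbours y; rewrite near1 near_y2 -card_prisoners_guards_at => hN.
pose T : {set square n} := setX (near x.1) [set k : 'I_n | k == x.2.+2 :> nat].
(* The neighbours of [y] in the columns of [x] and [y], apart from [x], are neighbours of [x], hence
   prisoners. *)
have subT : guards_at y \subset x |: T.
  apply/subsetP => z; rewrite inE => /andP[gz yz].
  rewrite in_setU1; case: (eqVneq z x) => //= zx.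
  have : ~~ adjacent x z by apply/negP => /nbr; move: gz; rewrite inE => /negbTE ->.
  rewrite adjacentE zx; move: yz; rewrite adjacentE !inE /=.
  by lia.
have cT : #|x |: T| = 1 + 3 * (x.2.+2 < n).
  rewrite cardsU1 cardsX card_ord_eq near1; congr (_ + _).
  by rewrite !inE (ltn_eqF (leqnSn x.2.+1)) andbF.
have := subset_leq_card subT; rewrite cT => le.
(* Otherwise [T] is empty and [y] has 5 neighbours with at most one guard, against validity. *)
have lt2 : x.2.+2 < n by move: le; case: ltnP => //; lia.
split=> // z z1 z2.
(* Now [y] has 8 neighbours, so at least 4 guards, while [x |: T] has exactly 4 squares. *)
have /eqP eqT : guards_at y == x |: T.
  by rewrite eqEcard subT cT lt2; lia.
have : z \in x |: T by rewrite in_setU1 inE z1 inE z2 eqxx orbT.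
by rewrite -eqT inE => /andP[].
Qed.

Lemma shift2_isolated x : x \in isolated_guards ->
  shift2 x \in guards c /\ #|prisoners_at (shift2 x)| <= 6.
Proof.
move=> Ax; have [near1 _ _] := isolated_guardP Ax.
have [lt2 gT] := guards_right_of_isolated Ax.
have s2 : (shift2 x).2 = x.2.+2 :> nat by rewrite /= val_insubd lt2.
have s1 : (shift2 x).1 \in near x.1 by rewrite inE !leqnSn.
split; first exact: gT.
pose T : {set square n} := setX (near x.1) [set k : 'I_n | k == x.2.+2 :> nat].
have sub : T :\ shift2 x \subset guards_at (shift2 x).
  apply/subsetP => z; rewrite in_setD1 inE [z.2 \in _]inE => /and3P[zs z1 /eqP z2].
  rewrite inE gT // adjacentE zs inE [z.2 \in _]inE s2 z2.
  by rewrite z1 !leqnSn.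
have cT : #|T| = 3 by rewrite cardsX card_ord_eq near1 lt2.
have sT : shift2 x \in T by rewrite inE s1 inE s2 eqxx.
have cTD : #|T :\ shift2 x| = 2.
  by have := cardsD1 (shift2 x) T; rewrite sT cT => -[].
have ge2 : 2 <= #|guards_at (shift2 x)| by rewrite -cTD; exact: subset_leq_card.
have := card_neighbours_le8 (shift2 x).
by rewrite -card_prisoners_guards_at; lia.
Qed.

(** On isolated guards the target column is on the board, so the default of [insubd] never
    occurs. *)
Lemma shift2_inj : {in isolated_guards &, injective shift2}.
Proof.
move=> [i j] [k l] /guards_right_of_isolated[/= ltj _].
move=> /guards_right_of_isolated[/= ltl _] [-> /(congr1 val)].
by rewrite !val_insubd ltj ltl => -[] /val_inj ->.
Qed.

(** * Averaging over the guards and the final count *)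

Lemma sum_prisoners_at :
  \sum_(y in guards c) #|prisoners_at y| <= 7 * #|guards c|.
Proof.
set A := isolated_guards; set B := [set shift2 x | x in A].
have cardB : #|B| = #|A| by rewrite card_in_imset //; exact: shift2_inj.
have sum_sub (D : {set square n}) :
    D \subset guards c -> \sum_(y in guards c) (y \in D : nat) = #|D|.
  move=> subD; rewrite -sum1_card big_mkcond [RHS]big_mkcond; apply: eq_bigr => y _.
  by have := subsetP subD y; case: (y \in D) => [->|_] //; case: ifP.
have subA : A \subset guards c by apply/subsetP => y; rewrite inE => /andP[].
have subB : B \subset guards c.
  by apply/subsetP => _ /imsetP[x /shift2_isolated[]] ? _ ->.
(* Squares of [B] have one unit to spare below 7, and those of [A] exceed 7 by at most one; the two
   corrections cancel since [A] and [B] have equal size. *)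
have key : \sum_(y in guards c) (#|prisoners_at y| + (y \in B)) <=
           \sum_(y in guards c) (7 + (y \in A)).
  apply: leq_sum => y gy; case: (boolP (y \in B)) => [/imsetP[x Ax ->]|_].
    by have [_] := shift2_isolated Ax; lia.
  rewrite addn0 [y \in A]inE gy /=; case: ltnP => //= _.
  rewrite (leq_trans _ (card_neighbours_le8 y)) //.
  by rewrite -card_prisoners_guards_at leq_addr.
move: key; rewrite !big_split /= !sum_sub // cardB leq_add2r.
by rewrite sum_nat_const mulnC.
Qed.

(** With [p] prisoners, double counting gives [4p <= 7(n^2 - p) + 4n]. *)
Lemma valid_bound : 11 * #|prisoners c| <= 7 * n ^ 2 + 4 * n.
Proof.
have le4 : 4 * #|prisoners c| <=
    \sum_(x in prisoners c) #|guards_at x| + \sum_(x in prisoners c) side_count x.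
  rewrite -big_split /= mulnC -sum_nat_const; apply: leq_sum => x.
  exact: guards_at_ge.
have le_side : \sum_(x in prisoners c) side_count x <= 4 * n.
  apply: leq_trans sum_side_count; rewrite big_mkcond /=.
  by apply: leq_sum => x _; case: ifP.
have tot : #|prisoners c| + #|guards c| = n ^ 2.
  by rewrite cardsC card_prod card_ord.
move: le4 sum_prisoners_at; rewrite sum_guards_at; lia.
Qed.

End Board.

Local Open Scope ring_scope.

Theorem theorem4p5 (n : nat) (hn : (3 <= n)%N) :
  (P n)%:R <= (7 * n%:R ^+ 2 + 4 * n%:R) / 11 :> rat.
Proof.
have [c max_c] := exists_maximum_configuration n.
have /andP[valid_c _] := max_c.
have := valid_bound (ltnW hn) valid_c.
rewrite (card_maximum_configuration max_c) => le.
by rewrite ler_pdivlMr // mulrC -natrX -!natrM -natrD ler_nat.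
Qed.
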